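(* Let $d\geq 6$ and let $\sigma_\bullet$ be the sign pattern $(+,-,+,+,\ldots,+,+,-,+)$ of length $d+1$. Then the set $A(\sigma_\bullet,(2,d-4))$ is non-empty and is not connected; more precisely, it is the union of more than one connected component of the set $R_{3,d}$.
   Context: Identify a monic real polynomial $Q_d=x^d+\sum_{j=0}^{d-1}a_jx^j$ with its coefficient vector $(a_{d-1},\ldots,a_0)\in\mathbb{R}^d$. A sign pattern of length $d+1$ is a sequence of $d+1$ symbols $+$/$-$ beginning with $+$; a polynomial with all coefficients non-zero defines the sign pattern $(+,\operatorname{sign}(a_{d-1}),\ldots,\operatorname{sign}(a_0))$. $R_{3,d}\subset\mathbb{R}^d$ is the set of monic degree-$d$ polynomials with all coefficients $a_0,\ldots,a_{d-1}$ non-zero and with no multiple real root. $\sigma_\bullet=(+,-,+,+,\ldots,+,+,-,+)$ denotes the sign pattern of length $d+1$ in which the coefficients of $x^{d-1}$ and $x^1$ are negative and all other coefficients (including the leading one and the constant term) are positive. $A(\sigma_\bullet,(2,d-4))$ is the set of monic degree-$d$ polynomials with all coefficients non-zero and defining the sign pattern $\sigma_\bullet$, having exactly two positive roots and exactly $d-4$ negative roots, all real roots being simple, and (hence) exactly one pair of complex conjugate non-real roots. *)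

(* Defs.v *)
From HB Require Import structures.
From mathcomp Require Import all_boot all_order all_algebra.
From mathcomp Require Import all_classical all_reals all_analysis.
Set Implicit Arguments. Unset Strict Implicit. Unset Printing Implicit Defensive.
Import Order.TTheory GRing.Theory Num.Theory.
Local Open Scope ring_scope.
Local Open Scope classical_set_scope.

Definition Qpoly (R : realType) (d : nat) (a : 'rV[R]_d) : {poly R} :=
  'X^d + \sum_(j < d) (a ord0 j)%:P * 'X^j.

Definition all_coef_nonzero (R : realType) (d : nat) (a : 'rV[R]_d) : Prop :=
  forall j : 'I_d, a ord0 j != 0.

Definition no_multiple_real_root (R : realType) (p : {poly R}) : Prop :=
  forall x : R, root p x -> ~~ root p^`() x.

Definition R3 (R : realType) (d : nat) : set 'rV[R]_d :=
  [set a | all_coef_nonzero a /\ no_multiple_real_root (Qpoly a)].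

Definition sigma_bullet (R : realType) (d : nat) (a : 'rV[R]_d) : Prop :=
  forall j : 'I_d,
    if ((j == d.-1 :> nat) || (j == 1%N :> nat)) then a ord0 j < 0 else 0 < a ord0 j.

Definition nroots_in (R : realType) (p : {poly R}) (S : set R) (n : nat) : Prop :=
  exists s : seq R, [/\ uniq s, size s = n &
    forall x : R, (x \in s) <-> (S x /\ root p x)].

Definition Aset (R : realType) (d : nat) : set 'rV[R]_d :=
  [set a | [/\ all_coef_nonzero a, sigma_bullet a,
              no_multiple_real_root (Qpoly a),
              nroots_in (Qpoly a) [set x | 0 < x] 2 &
              nroots_in (Qpoly a) [set x | x < 0] (d - 4)]].

Arguments R3 : clear implicits.
Arguments Aset : clear implicits.

(* Main.v *)
(** A polynomial of [R3] keeps its sign pattern and its numbers of positive and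
    negative roots under a small perturbation, so [Aset] is open and closed in
    [R3]. A polynomial [Q] of [Aset] never has both [x] and [- x] as roots
    (compare the even and the odd part of [Q]); hence "some negative root has
    larger modulus than some positive root" is also a locally constant property
    on [Aset]. It fails for [(X-1)(X-2)prod(X+e_i)(X^2-eX+e^2)] with rapidly
    decreasing [e_i] and [e], and it holds for the same product with rapidly
    increasing large parameters; both products have the right sign pattern. *)

Require Import Defs.
From HB Require Import structures.
From mathcomp Require Import all_boot all_order all_algebra.
From mathcomp Require Import all_classical all_reals all_analysis.
From mathcomp Require Import separable.
From mathcomp Require polyrcf.
From mathcomp Require Import zify ring lra.
Import Order.TTheory GRing.Theory Num.Theory.
Import numFieldNormedType.Exports.
Local Open Scope ring_scope.
Local Open Scope classical_set_scope.

Set Implicit Arguments. Unset Strict Implicit. Unset Printing Implicit Defensive.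

(** * Continuity of evaluation and persistence of roots *)

Lemma cvg_exprn (R : realType) (T : Type) (F : set_system T) (FF : Filter F)
    (f : T -> R) (x : R) (n : nat) :
  f @ F --> x -> (fun t => f t ^+ n) @ F --> x ^+ n.
Proof.
move=> fx; exact: (@continuous_cvg _ _ _ F FF f _ x (@exprn_continuous R n x) fx).
Qed.

Lemma horner_Qpoly (R : realType) (d : nat) (a : 'rV[R]_d) (x : R) :
  (Qpoly a).[x] = x ^+ d + \sum_(j < d) a ord0 j * x ^+ j.
Proof.
rewrite /Qpoly hornerD hornerXn horner_sum; congr (_ + _).
by apply: eq_bigr => j _; rewrite hornerM hornerC hornerXn.
Qed.

Lemma cvg_coord (R : realType) (d : nat) (T : Type) (F : set_system T)
    (FF : Filter F) (f : T -> 'rV[R]_d) (b : 'rV[R]_d) (j : 'I_d) :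
  f @ F --> b -> (fun t => f t ord0 j) @ F --> b ord0 j.
Proof.
move=> fb.
exact: (@continuous_cvg _ _ _ F FF f _ b (@coord_continuous R 1 d ord0 j b) fb).
Qed.

Lemma cvg_Qpoly (R : realType) (d : nat) (T : Type) (F : set_system T)
    (FF : Filter F) (f : T -> 'rV[R]_d) (g : T -> R) (b : 'rV[R]_d) (x : R) :
  f @ F --> b -> g @ F --> x ->
  (fun t => (Qpoly (f t)).[g t]) @ F --> (Qpoly b).[x].
Proof.
move=> fb gx; rewrite horner_Qpoly.
under eq_fun do rewrite horner_Qpoly.
apply: cvgD; first exact: cvg_exprn.
apply: cvg_big => [|j _]; first exact: add_continuous.
by apply: cvgM; [exact: cvg_coord|exact: cvg_exprn].
Qed.

(* The divided difference [(Q_a(x) - Q_a(y)) / (x - y)], written as a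
   polynomial so that it extends continuously to [x = y]. *)
Definition Qslope (R : realType) (d : nat) (a : 'rV[R]_d) (x y : R) : R :=
  \sum_(i < d) x ^+ (d.-1 - i) * y ^+ i
  + \sum_(j < d) a ord0 j * \sum_(i < j) x ^+ (j.-1 - i) * y ^+ i.

Lemma QslopeE (R : realType) (d : nat) (a : 'rV[R]_d) (x y : R) :
  (Qpoly a).[x] - (Qpoly a).[y] = (x - y) * Qslope a x y.
Proof.
rewrite !horner_Qpoly /Qslope opprD addrACA subrXX mulrDr; congr (_ + _).
rewrite -sumrB mulr_sumr; apply: eq_bigr => j _.
by rewrite -mulrBr subrXX mulrCA.
Qed.

(** Simplicity of a root thus becomes the non-vanishing of a function that is continuous in the
    polynomial and in two points. *)
Lemma Qslope_diag (R : realType) (d : nat) (a : 'rV[R]_d) (x : R) :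
  Qslope a x x = (Qpoly a)^`().[x].
Proof.
have sumX m : \sum_(i < m) x ^+ (m.-1 - i) * x ^+ i = x ^+ m.-1 *+ m.
  rewrite (eq_bigr (fun=> x ^+ m.-1)) ?sumr_const ?card_ord// => i _.
  by rewrite -exprD subnK// -ltnS (ltn_predK (ltn_ord i)).
rewrite /Qslope /Qpoly derivD derivXn hornerD hornerMn hornerXn raddf_sum.
rewrite horner_sum sumX; congr (_ + _); apply: eq_bigr => j _; rewrite sumX.
by rewrite /= derivM derivC mul0r add0r derivXn hornerM hornerC hornerMn hornerXn.
Qed.

Lemma cvg_Qslope (R : realType) (d : nat) (T : Type) (F : set_system T)
    (FF : Filter F) (f : T -> 'rV[R]_d) (g h : T -> R) (b : 'rV[R]_d) (x y : R) :
  f @ F --> b -> g @ F --> x -> h @ F --> y ->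
  (fun t => Qslope (f t) (g t) (h t)) @ F --> Qslope b x y.
Proof.
move=> fb gx hy; have sumC m : (fun t => \sum_(i < m) g t ^+ (m.-1 - i) * h t ^+ i)
    @ F --> \sum_(i < m) x ^+ (m.-1 - i) * y ^+ i.
  apply: cvg_big => [|i _]; first exact: add_continuous.
  by apply: cvgM; exact: cvg_exprn.
apply: cvgD; first exact: sumC.
apply: cvg_big => [|j _]; first exact: add_continuous.
by apply: cvgM; [exact: cvg_coord|exact: sumC].
Qed.

Lemma Qpoly_neq0 (R : realType) (d : nat) (a : 'rV[R]_d) : Qpoly a != 0.
Proof.
have sz : (size (\sum_(j < d) (a ord0 j)%:P * 'X^j)%R <= d)%N.
  apply: (leq_trans (size_sum _ _ _)); apply/bigmax_leqP => j _.
  by rewrite mul_polyC (leq_trans (size_scale_leq _ _))// size_polyXn.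
by rewrite -size_poly_gt0 /Qpoly size_polyDl size_polyXn // ltnS.
Qed.

(** Cauchy's bound. If [|x| > 1], all lower powers are at most [|x|^(d-1)], and this power cancels
    from the root equation. The bound is continuous in [a]. *)
Lemma root_Qpoly_bound (R : realType) (d : nat) (a : 'rV[R]_d) (x : R) :
  root (Qpoly a) x -> `|x| <= 1 + \sum_(j < d) `|a ord0 j|.
Proof.
rewrite rootE horner_Qpoly addr_eq0 => /eqP xd.
have S0 : 0 <= \sum_(j < d) `|a ord0 j| by apply: sumr_ge0 => j _; exact: normr_ge0.
have [x1|x1] := leP `|x| 1; first by rewrite (le_trans x1)// lerDl.
case: d a xd S0 => [|d] a xd S0.
  by move: xd; rewrite big_ord0 oppr0 expr0 => /eqP; rewrite oner_eq0.
have xd0 : 0 < `|x| ^+ d by rewrite exprn_gt0// (lt_trans ltr01).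
have : `|x| ^+ d.+1 <= (\sum_(j < d.+1) `|a ord0 j|) * `|x| ^+ d.
  rewrite -normrX xd normrN (le_trans (ler_norm_sum _ _ _))// mulr_suml.
  apply: ler_sum => j _; rewrite normrM normrX ler_wpM2l//.
  by rewrite ler_weXn2l// ?ltW// -ltnS.
by rewrite exprS ler_pM2r// => /le_trans; apply; rewrite lerDr.
Qed.

(* The roots of polynomials close to [b] all lie in a fixed compact box. *)
Lemma near_root_tuples (R : realType) (d k : nat) (b : 'rV[R]_d)
    (P : 'rV[R]_d -> 'rV[R]_k -> Prop) :
  (forall r : 'rV[R]_k, \forall r' \near r & a \near b, P a r') ->
  \forall a \near b, forall r : 'rV[R]_k, (forall i, root (Qpoly a) (r ord0 i)) -> P a r.
Proof.
(* [M] exceeds the root bound at [b] by one, so it still bounds all roots for [a] near [b]. *)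
move=> Ploc; pose M := 2 + \sum_(j < d) `|b ord0 j|.
have cvS : (fun a : 'rV[R]_d => 1 + \sum_(j < d) `|a ord0 j|) @ nbhs b
    --> 1 + \sum_(j < d) `|b ord0 j|.
  apply: cvgD; first exact: cvg_cst.
  apply: cvg_big => [|j _]; first exact: add_continuous.
  by apply: cvg_norm; apply: cvg_coord; exact: cvg_id.
have bnd : nbhs b (fun a : 'rV[R]_d => 1 + \sum_(j < d) `|a ord0 j| < M).
  by apply: (cvgr_lt _ cvS); rewrite /M ltrD2r ltr1n.
have cK : compact [set r : 'rV[R]_k | forall i, `[- M, M]%classic (r ord0 i)].
  by apply: (@rV_compact _ _ (fun=> _)) => i; exact: segment_compact.
(* Compactness of the box makes a single neighbourhood of [b] serve all tuples [r] in it. *)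
have cov := proj1 (compact_near_coveringP _) cK _ (nbhs b) P (nbhs_filter b) (fun r _ => Ploc r).
apply: (filterS2 _ _ bnd cov) => a aM PK r rr; apply: PK => i /=.
rewrite in_itv/= -ler_norml.
exact: (le_trans (root_Qpoly_bound (rr i)) (ltW aM)).
Qed.

(* Near a simple root [x] of [Q_b] the slope has constant sign, so [Q_b]
   changes sign at [x]; the two opposite values survive a perturbation. *)
Lemma near_simple_root (R : realType) (d : nat) (b : 'rV[R]_d) (x : R)
    (U : set R) :
  nbhs x U -> root (Qpoly b) x -> ~~ root (Qpoly b)^`() x ->
  \forall a \near b, exists2 y, U y & root (Qpoly a) y.
Proof.
move=> Ux rx sx.
have Q0 : (Qpoly b).[x] = 0 by apply/eqP.
have cD : (fun y => Qslope b y x * Qslope b x x) @ nbhs x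
    --> Qslope b x x * Qslope b x x.
  apply: cvgM; last exact: cvg_cst.
  by apply: cvg_Qslope; [exact: cvg_cst|exact: cvg_id|exact: cvg_cst].
have Dx : nbhs x (fun y => 0 < Qslope b y x * Qslope b x x).
  apply: (cvgr_gt _ cD).
  by rewrite -expr2 Qslope_diag exprn_even_gt0//= -rootE.
have /nbhs_ballP[e /= e0 He] : nbhs x (U `&` [set y | 0 < Qslope b y x * Qslope b x x]).
  exact: filterI.
pose u := x - e / 2; pose v := x + e / 2.
have inU y : u <= y <= v -> U y /\ 0 < Qslope b y x * Qslope b x x.
  rewrite /u /v => /andP[? ?]; apply: He; rewrite /ball/= ltr_norml.
  by apply/andP; split; lra.
have uv : u <= v by rewrite /u /v; lra.
have /inU[_ Du] : u <= u <= v by rewrite lexx.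
have /inU[_ Dv] : u <= v <= v by rewrite uv lexx.
have Qu : (Qpoly b).[u] = - (e / 2) * Qslope b u x.
  by rewrite -[LHS]subr0 -Q0 QslopeE /u; congr (_ * _); ring.
have Qv : (Qpoly b).[v] = e / 2 * Qslope b v x.
  by rewrite -[LHS]subr0 -Q0 QslopeE /v; congr (_ * _); ring.
have Quv : (Qpoly b).[u] * (Qpoly b).[v] < 0.
  (* Both slopes have the sign of [Qslope b x x], so their product is positive. *)
  have : 0 < Qslope b u x * Qslope b v x * (Qslope b x x) ^+ 2.
    by rewrite expr2 mulrACA mulr_gt0.
  rewrite pmulr_lgt0 ?exprn_even_gt0//=; last by rewrite Qslope_diag -rootE.
  move=> Duv; rewrite Qu Qv mulrACA mulNr nmulr_rlt0// oppr_lt0.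
  by rewrite mulr_gt0// divr_gt0.
have cQ : (fun a : 'rV[R]_d => (Qpoly a).[u] * (Qpoly a).[v]) @ nbhs b
    --> (Qpoly b).[u] * (Qpoly b).[v].
  by apply: cvgM; apply: cvg_Qpoly; (exact: cvg_id || exact: cvg_cst).
have nQ : nbhs b (fun a : 'rV[R]_d => (Qpoly a).[u] * (Qpoly a).[v] < 0).
  exact: (cvgr_lt _ cQ _ Quv).
apply: (filterS _ nQ) => a Qa.
have [y] := polyrcf.poly_ivtoo uv Qa.
rewrite in_itv/= => /andP[uy yv] ry; exists y => //.
by have /inU[] : u <= y <= v by rewrite !ltW.
Qed.

Lemma notin_dist (R : realType) (x : R) (s : seq R) :
  x \notin s -> exists2 e : R, 0 < e & forall y, y \in s -> e < `|y - x|.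
Proof.
elim: s => [_|z s IH]; first by exists 1.
rewrite inE negb_or => /andP[xz /IH[e e0 es]].
have zx : 0 < `|z - x| by rewrite normr_gt0 subr_eq0 eq_sym.
exists (Num.min e (`|z - x| / 2)); first by rewrite lt_min e0 divr_gt0.
move=> y; rewrite inE gt_min => /predU1P[->|/es -> //].
by rewrite orbC ltr_pdivrMr// ltr_pMr// ltr1n.
Qed.

(** Each root persists by [near_simple_root]. They stay distinct because the induction, run for
    arbitrary [J], looks for the remaining roots outside a closed ball about the first one. *)
Lemma near_roots_ge (R : realType) (d : nat) (b : 'rV[R]_d) (s : seq R)
    (J : set R) :
  no_multiple_real_root (Qpoly b) -> open J -> uniq s ->
  (forall x, x \in s -> J x /\ root (Qpoly b) x) ->
  \forall a \near b, exists s' : seq R, [/\ uniq s', size s' = size s &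
    forall x, x \in s' -> J x /\ root (Qpoly a) x].
Proof.
move=> simple_b; elim: s J => [|x s IH] J Jo /=.
  by move=> _ _; apply: filterE => a; exists [::].
move=> /andP[xs us] rs; have [e e0 es] := notin_dist xs.
have far_open : open [set y : R | e < `|y - x|].
  apply: (open_comp (f := fun y => `|y - x|) (D := [set t | e < t])) => //.
  move=> y _; apply: cvg_norm; apply: cvgB; [exact: cvg_id|exact: cvg_cst].
have [Jx rx] := rs _ (mem_head _ _).
have nx : nbhs x (J `&` ball x e).
  by apply: filterI; [exact: open_nbhs_nbhs|exact: nbhsx_ballx].
have near1 := near_simple_root nx rx (simple_b _ rx).
have rs2 y : y \in s -> (J `&` [set y | e < `|y - x|]) y /\ root (Qpoly b) y.
  move=> ys; have [? ?] : J y /\ root (Qpoly b) y by apply: rs; rewrite inE ys orbT.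
  by split=> //; split=> //; exact: es.
have near2 := IH _ (openI Jo far_open) us rs2.
apply: (filterS2 _ _ near1 near2) => a.
move=> [y [Jy yx] ry] [s' [us' ss' rs']]; exists (y :: s'); split => /=.
- rewrite us' andbT; apply/negP => /rs'[[_ /= ey] _].
  by move: yx; rewrite /ball/= distrC => /(lt_trans ey); rewrite ltxx.
- by rewrite ss'.
- by move=> z; rewrite inE => /predU1P[->//|/rs'[[]]].
Qed.

(** Near a tuple of [n+1] roots of [Q_b] in [J], two entries of which must agree, the slope at these
    entries is non-zero, so the perturbed roots agree too. Closedness of [J] is asked away from [0]
    only, as [0] is not a root. *)
Lemma near_roots_le (R : realType) (d n : nat) (b : 'rV[R]_d) (J : set R) :
  no_multiple_real_root (Qpoly b) -> (Qpoly b).[0] != 0 ->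
  (forall x : R, x != 0 -> ~ J x -> \forall y \near x, ~ J y) ->
  nroots_in (Qpoly b) J n ->
  \forall a \near b, forall r : 'rV[R]_n.+1,
    (forall i, root (Qpoly a) (r ord0 i)) -> (forall i, J (r ord0 i)) ->
    exists i j, i != j /\ r ord0 i = r ord0 j.
Proof.
move=> simple_b b0 Jc [s [us ss rs]].
pose P (a : 'rV[R]_d) (r : 'rV[R]_n.+1) :=
  (forall i, root (Qpoly a) (r ord0 i)) -> (forall i, J (r ord0 i)) ->
    exists i j, i != j /\ r ord0 i = r ord0 j.
have Ploc (r : 'rV[R]_n.+1) : \forall r' \near r & a \near b, P a r'.
  have cvr i : (fun z : 'rV[R]_n.+1 * 'rV[R]_d => z.1 ord0 i) @ nbhs (r, b)
      --> r ord0 i by apply: cvg_coord; exact: cvg_fst.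
  have cva : (fun z : 'rV[R]_n.+1 * 'rV[R]_d => z.2) @ nbhs (r, b) --> b.
    exact: cvg_snd.
  (* Unless every entry of [r] is a root of [Q_b] in [J], one premise of [P] fails throughout a
     neighbourhood of [(r, b)]. *)
  have [rr|] := pselect (forall i, root (Qpoly b) (r ord0 i)); last first.
    move=> /existsNP[i /negP ri].
    have near_i : nbhs (r, b) (fun z : 'rV[R]_n.+1 * 'rV[R]_d => (Qpoly z.2).[z.1 ord0 i] != 0).
      exact: (cvgr_neq0 _ (cvg_Qpoly _ cva (cvr i)) ri).
    by apply: (filterS _ near_i) => -[r' a]/= ra; move=> /(_ i); rewrite rootE (negPf ra).
  have r0 i : r ord0 i != 0.
    by apply: contraTneq (rr i) => ->; rewrite rootE.
  have [rJ|] := pselect (forall i, J (r ord0 i)); last first.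
    move=> /existsNP[i Ji].
    have near_i : nbhs (r, b) (fun z : 'rV[R]_n.+1 * 'rV[R]_d => ~ J (z.1 ord0 i)).
      exact: (cvr i _ (Jc _ (r0 i) Ji)).
    by apply: (filterS _ near_i) => -[r' a]/= nJ _ /(_ i).
  (* Pigeonhole: [n+1] entries among only [n] roots. *)
  have : ~~ injectiveb (fun i => r ord0 i).
    apply/negP => /injectiveP inj_r.
    have : (size (map (fun i => r ord0 i) (enum 'I_n.+1)) <= size s)%N.
      apply: uniq_leq_size => [|x /mapP[i _ ->]]; first by rewrite map_inj_uniq ?enum_uniq.
      by apply/rs.
    by rewrite size_map size_enum_ord ss ltnn.
  move=> /injectivePn[i [j ij rij]].
  have sl : Qslope b (r ord0 i) (r ord0 j) != 0.
    by rewrite -rij Qslope_diag -rootE; exact: simple_b.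
  have near_ij : nbhs (r, b)
      (fun z : 'rV[R]_n.+1 * 'rV[R]_d => Qslope z.2 (z.1 ord0 i) (z.1 ord0 j) != 0).
    exact: (cvgr_neq0 _ (cvg_Qslope _ cva (cvr i) (cvr j)) sl).
  apply: (filterS _ near_ij) => -[r' a]/= sl' ra _; exists i, j; split=> //.
  apply/eqP; rewrite -subr_eq0; have /eqP := QslopeE a (r' ord0 i) (r' ord0 j).
  by rewrite (eqP (ra i)) (eqP (ra j)) subrr eq_sym mulf_eq0 (negPf sl') orbF.
by apply: (filterS _ (near_root_tuples Ploc)) => a Pa r rr; exact: Pa.
Qed.

Lemma near_nroots (R : realType) (d n : nat) (b : 'rV[R]_d) (J : set R) :
  no_multiple_real_root (Qpoly b) -> (Qpoly b).[0] != 0 -> open J ->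
  (forall x : R, x != 0 -> ~ J x -> \forall y \near x, ~ J y) ->
  nroots_in (Qpoly b) J n -> \forall a \near b, nroots_in (Qpoly a) J n.
Proof.
move=> simple_b b0 Jo Jc Jn; have near_le := near_roots_le simple_b b0 Jc Jn.
case: Jn => s [us ss rs].
have near_ge := near_roots_ge simple_b Jo us (fun x => proj1 (rs x)).
apply: (filterS2 _ _ near_ge near_le) => a [s' [us' ss' rs']] le_a; rewrite ss in ss'.
exists s'; split=> // x; split=> [/rs'//|[Jx rx]]; apply/negPn/negP => xs'.
(* A root in [J] missing from [s'] would yield [n+1] pairwise distinct ones. *)
pose r := \row_(i < n.+1) nth 0 (x :: s') i.
have rP i : J (r ord0 i) /\ root (Qpoly a) (r ord0 i).
  rewrite mxE; have : nth 0 (x :: s') i \in x :: s' by rewrite mem_nth//= ss'.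
  by rewrite inE => /predU1P[->//|/rs'].
have [i [j [ij]]] := le_a r (fun i => proj2 (rP i)) (fun i => proj1 (rP i)).
have inj := nth_uniq 0 (s := x :: s') (i := i) (j := j).
rewrite !mxE => /eqP; rewrite inj /= ?ss' ?xs' ?us' ?ltn_ord//.
by move=> /eqP/ord_inj/eqP; rewrite (negPf ij).
Qed.

Lemma nroots_in_inj (R : realType) (p : {poly R}) (J : set R) (m n : nat) :
  nroots_in p J m -> nroots_in p J n -> m = n.
Proof.
move=> [s [us <- rs]] [t [ut <- rt]].
by apply/perm_size/uniq_perm => // x; apply/idP/idP => [/rs/rt|/rt/rs].
Qed.

Lemma nroots_in_ex (R : realType) (p : {poly R}) (J : set R) :
  p != 0 -> exists n, nroots_in p J n.
Proof.
move=> p0; pose s := [seq x <- polyrcf.rootsR p | `[< J x >]].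
exists (size s), s; split=> //; first exact/filter_uniq/polyrcf.uniq_roots.
move=> x; rewrite mem_filter -(polyrcf.roots_on_rootsR p0) in_itv/=.
by split=> [/andP[/asboolP]//|[Jx ->]]; rewrite andbT; apply/asboolP.
Qed.

(** The true count [m] at [b] persists and counts are unique, so having a number of roots other than
    [n] persists as well. *)
Lemma near_nroots_iff (R : realType) (d n : nat) (b : 'rV[R]_d) (J : set R) :
  no_multiple_real_root (Qpoly b) -> (Qpoly b).[0] != 0 -> open J ->
  (forall x : R, x != 0 -> ~ J x -> \forall y \near x, ~ J y) ->
  \forall a \near b, nroots_in (Qpoly a) J n <-> nroots_in (Qpoly b) J n.
Proof.
move=> simple_b b0 Jo Jc; have [m bm] := nroots_in_ex J (Qpoly_neq0 b).
apply: (filterS _ (near_nroots simple_b b0 Jo Jc bm)) => a am.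
by split=> [/(nroots_in_inj am) <-|/(nroots_in_inj bm) <-].
Qed.

(** * Locally constant properties on connected components *)

(** Within the component, [S] is relatively open and relatively closed, and it contains [x]. *)
Lemma connected_component_locally_const (T : topologicalType) (A S : set T) x :
  (forall y, A y -> \forall z \near y, A z -> (S z <-> S y)) ->
  A x -> S x -> connected_component A x `<=` S.
Proof.
move=> Sloc Ax Sx.
have cC := component_connected (A := A) (x := x).
have CA := @connected_component_sub _ A x.
suff <- : connected_component A x `&` S = connected_component A x by move=> y [].
apply: cC.
- by exists x; split=> //; exact: connected_component_refl.
(* Local constancy is known only inside [A], so the open set is the interior of an implication; the
   closed set below is obtained dually from [~ S]. *)
- exists (interior [set y | A y -> S y]); first exact: open_interior.
  rewrite eqEsubset; split=> y [Cy Sy]; split=> //.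
    by apply: (filterS _ (Sloc _ (CA _ Cy))) => z Sz /Sz/iffRL; exact.
  by apply: (interior_subset Sy); exact: CA.
- exists (~` interior [set y | A y -> ~ S y]).
    by apply: open_closedC; exact: open_interior.
  rewrite eqEsubset; split=> y [Cy Sy]; split=> //.
    by move=> /interior_subset/(_ (CA _ Cy)).
  apply: contrapT => nSy; apply: Sy.
  by apply: (filterS _ (Sloc _ (CA _ Cy))) => z Sz /Sz/iffLR/[apply].
Qed.

Lemma horner_Qpoly0 (R : realType) (d : nat) (a : 'rV[R]_d) :
  (0 < d)%N -> all_coef_nonzero a -> (Qpoly a).[0] != 0.
Proof.
case: d a => // d a _ a0; rewrite horner_Qpoly expr0n add0r big_ord_recl/=.
rewrite mulr1 big1 ?addr0 => [|i _]; last by rewrite expr0n mulr0.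
exact: a0.
Qed.

Lemma eq_sgr_lt0 (R : realType) (x y : R) :
  Num.sg x = Num.sg y -> (x < 0) = (y < 0).
Proof. by move=> E; rewrite -sgr_lt0 E sgr_lt0. Qed.

Lemma eq_sgr_gt0 (R : realType) (x y : R) :
  Num.sg x = Num.sg y -> (0 < x) = (0 < y).
Proof. by move=> E; rewrite -sgr_gt0 E sgr_gt0. Qed.

Lemma near_sgr (R : realType) (T : Type) (F : set_system T) (FF : Filter F)
    (f : T -> R) (c : R) :
  f @ F --> c -> c != 0 -> \forall t \near F, Num.sg (f t) = Num.sg c.
Proof.
move=> fc; rewrite neq_lt => /orP[c0|c0].
  have near_c : F (fun t => f t < 0) by exact: (cvgr_lt _ fc).
  by apply: (filterS _ near_c) => t ft; rewrite !ltr0_sg.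
have near_c : F (fun t => 0 < f t) by exact: (cvgr_gt _ fc).
by apply: (filterS _ near_c) => t ft; rewrite !gtr0_sg.
Qed.

Lemma near_sigma_bullet (R : realType) (d : nat) (b : 'rV[R]_d) :
  all_coef_nonzero b -> \forall a \near b, sigma_bullet a <-> sigma_bullet b.
Proof.
move=> b0.
have near_j (j : 'I_d) :
    nbhs b (fun a : 'rV[R]_d => Num.sg (a ord0 j) = Num.sg (b ord0 j)).
  have cj : (fun a : 'rV[R]_d => a ord0 j) @ nbhs b --> b ord0 j.
    by apply: cvg_coord; exact: cvg_id.
  exact: (near_sgr _ cj (b0 j)).
apply: (filterS _ (filter_forall _ near_j)) => a sgE.
by split=> sa j; have := sa j; rewrite (eq_sgr_lt0 (sgE j)) (eq_sgr_gt0 (sgE j)).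
Qed.

Lemma near_Aset (R : realType) (d : nat) (b : 'rV[R]_d) :
  (0 < d)%N -> R3 R d b ->
  \forall a \near b, R3 R d a -> (Aset R d a <-> Aset R d b).
Proof.
move=> d0 [b0 simple_b]; have Q0 := horner_Qpoly0 d0 b0.
have near_pos : \forall a \near b, nroots_in (Qpoly a) [set x | 0 < x] 2 <->
    nroots_in (Qpoly b) [set x | 0 < x] 2.
  apply: near_nroots_iff => // x x0 /negP.
  by rewrite -leNgt le_eqVlt (negPf x0)/= => /lt_nbhsl; apply: filterS => y /= /ltW; rewrite leNgt => /negP.
have near_neg : \forall a \near b, nroots_in (Qpoly a) [set x | x < 0] (d - 4) <->
    nroots_in (Qpoly b) [set x | x < 0] (d - 4).
  apply: near_nroots_iff => // x x0 /negP.
  by rewrite -leNgt le_eqVlt eq_sym (negPf x0)/= => /lt_nbhsr; apply: filterS => y /= /ltW; rewrite leNgt => /negP.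
apply: (filterS3 _ _ (near_sigma_bullet b0) near_pos near_neg) => a sE pE nE [a0 simple_a].
by split=> -[? /sE ? ? /pE ? /nE ?].
Qed.

(** * Comparing the moduli of positive and negative roots *)

Lemma coef_Qpoly (R : realType) (d : nat) (a : 'rV[R]_d) (j : 'I_d) :
  (Qpoly a)`_j = a ord0 j.
Proof.
rewrite /Qpoly coefD coefXn ltn_eqF// add0r coef_sum (bigD1 j)//= coefCM coefXn.
rewrite eqxx mulr1 big1 ?addr0// => i ij; rewrite coefCM coefXn.
by rewrite [val j == i]eq_sym (negPf ij : (val i == val j) = false) mulr0.
Qed.

Lemma horner_Qpoly_coef (R : realType) (d : nat) (a : 'rV[R]_d) (x : R) :
  (Qpoly a).[x] = \sum_(i < d.+1) (Qpoly a)`_i * x ^+ i.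
Proof.
rewrite big_ord_recr horner_Qpoly [LHS]addrC /=; congr (_ + _).
  by apply: eq_bigr => j _; rewrite coef_Qpoly.
rewrite /Qpoly coefD coefXn eqxx coef_sum big1 ?addr0 ?mul1r// => i _.
by rewrite coefCM coefXn gtn_eqF ?mulr0.
Qed.

(** Includes [i = d], the leading coefficient, which [sigma_bullet] does not list. *)
Lemma coef_Qpoly_sign (R : realType) (d : nat) (a : 'rV[R]_d) (i : nat) :
  sigma_bullet a -> (i <= d)%N -> i != d.-1 -> i != 1%N -> 0 < (Qpoly a)`_i.
Proof.
move=> sa; rewrite leq_eqVlt => /predU1P[->|id] i1 i2.
  rewrite /Qpoly coefD coefXn eqxx coef_sum big1 ?addr0 ?ltr01// => j _.
  by rewrite coefCM coefXn gtn_eqF ?mulr0.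
have := sa (Ordinal id); rewrite /= (negPf i1) (negPf i2)/=.
by rewrite -coef_Qpoly.
Qed.

Lemma sumr_gt0_one (R : realType) (n : nat) (F : 'I_n -> R) (i : 'I_n) :
  (forall j, 0 <= F j) -> 0 < F i -> 0 < \sum_j F j.
Proof.
by move=> F0 Fi; rewrite (bigD1 i)//= ltr_pwDl// sumr_ge0.
Qed.

(* [Q(x) + Q(-x)] is positive when [d] is even. When [d] is odd,
   [(Q(x) + Q(-x)) / x^(d-1)] decreases and [(Q(x) - Q(-x)) / x] increases on
   the positive half-line, so that a common zero [x] of both would make [- x]
   the only negative root. *)
Lemma Aset_no_opposite_roots (R : realType) (d : nat) (a : 'rV[R]_d) (x : R) :
  (6 <= d)%N -> Aset R d a -> 0 < x ->
  root (Qpoly a) x -> ~ root (Qpoly a) (- x).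
Proof.
move=> d6 [a0 sa _ _ [s [us ss rs]]] x0 /eqP Qx /eqP QNx.
set p := Qpoly a in Qx QNx rs.
have evenE y : p.[y] + p.[- y] = \sum_(i < d.+1) p`_i * (1 + (-1) ^+ i) * y ^+ i.
  rewrite !horner_Qpoly_coef -big_split/=; apply: eq_bigr => i _.
  by rewrite [(- y) ^+ i]exprNn; ring.
have oddE y : p.[y] - p.[- y] = \sum_(i < d.+1) p`_i * (1 - (-1) ^+ i) * y ^+ i.
  rewrite !horner_Qpoly_coef -sumrB/=; apply: eq_bigr => i _.
  by rewrite [(- y) ^+ i]exprNn; ring.
have [dodd|deven] := boolP (odd d); last first.
  (* For even [d] the negative coefficients sit in the odd degrees [1] and [d-1], so the even part
     has only non-negative terms and a positive constant term. *)
  suff : 0 < p.[x] + p.[- x] by rewrite Qx QNx addr0 ltxx.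
  rewrite evenE; apply: (sumr_gt0_one (i := ord0)) => [i|]; last first.
    rewrite /= !expr0 mulr1 mulr_gt0// coef_Qpoly_sign//; lia.
  rewrite -signr_odd; case: (boolP (odd i)) => iodd.
    by rewrite expr1 subrr mulr0 mul0r.
  rewrite expr0 !mulr_ge0 ?exprn_ge0 ?ltW//; apply: coef_Qpoly_sign => //.
  - by rewrite -ltnS.
  - by move: (i : nat) iodd => k; lia.
  - by apply: contraNneq iodd => ->.
(* For odd [d] the only negative coefficient of even degree is that of [x^(d-1)], whose terms
   cancel; the constant term gives strictness. *)
have evenlt y z : 0 < y -> y < z ->
    (p.[z] + p.[- z]) * y ^+ d.-1 < (p.[y] + p.[- y]) * z ^+ d.-1.
  move=> y0 yz; have z0 := lt_trans y0 yz.
  rewrite -subr_gt0 !evenE !mulr_suml -sumrB.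
  have term (i : 'I_d.+1) : p`_i * (1 + (-1) ^+ i) * y ^+ i * z ^+ d.-1
      - p`_i * (1 + (-1) ^+ i) * z ^+ i * y ^+ d.-1
      = p`_i * (1 + (-1) ^+ i) * (y ^+ i * z ^+ d.-1 - z ^+ i * y ^+ d.-1) by ring.
  apply: (sumr_gt0_one (i := ord0)) => [i|]; rewrite term; last first.
    rewrite /= !expr0 !mul1r !mulr_gt0//; first by apply: coef_Qpoly_sign => //; lia.
    rewrite subr_gt0 ltrXn2r ?ltW//; lia.
  rewrite -signr_odd; case: (boolP (odd i)) => iodd.
    by rewrite expr1 subrr mulr0 mul0r.
  have [->|id1] := eqVneq (i : nat) d.-1.
    by rewrite [y ^+ _ * _]mulrC subrr mulr0.
  have il : (i <= d.-1)%N by have := ltn_ord i; move: (i : nat) iodd id1 => k; lia.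
  rewrite expr0 !mulr_ge0//.
    apply/ltW/coef_Qpoly_sign => //; first by rewrite -ltnS.
    by apply: contraNneq iodd => ->.
  rewrite subr_ge0 -[d.-1](subnKC il) !exprD mulrCA !ler_pM2l ?exprn_gt0//.
  by rewrite lerXn2r ?nnegrE ?(ltW y0) ?(ltW z0) ?(ltW yz).
(* Here the terms of degree [1], the only negative odd coefficient, cancel; the leading term gives
   strictness. *)
have oddlt y z : 0 < y -> y < z ->
    (p.[y] - p.[- y]) * z < (p.[z] - p.[- z]) * y.
  move=> y0 yz; have z0 := lt_trans y0 yz.
  rewrite -subr_gt0 !oddE !mulr_suml -sumrB.
  have term (i : 'I_d.+1) : p`_i * (1 - (-1) ^+ i) * z ^+ i * y
      - p`_i * (1 - (-1) ^+ i) * y ^+ i * z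
      = p`_i * (1 - (-1) ^+ i) * (z ^+ i * y - y ^+ i * z) by ring.
  have pw i : (1 < i)%N -> 0 < z ^+ i * y - y ^+ i * z.
    case: i => [//|[//|i]] _.
    rewrite subr_gt0 ![_ ^+ i.+2]exprSr -!mulrA [y * z]mulrC ltr_pM2r ?mulr_gt0//.
    by rewrite ltrXn2r// ltW.
  apply: (sumr_gt0_one (i := ord_max)) => [i|]; rewrite term; last first.
    rewrite /= -signr_odd dodd expr1 opprK !mulr_gt0 ?pw//; last by lia.
    by apply: coef_Qpoly_sign => //; lia.
  rewrite -signr_odd; case: (boolP (odd i)) => iodd; last first.
    by rewrite expr0 subrr mulr0 mul0r.
  have [->|i1] := eqVneq (i : nat) 1%N.
    by rewrite !expr1 [z * y]mulrC subrr mulr0.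
  rewrite expr1 opprK !mulr_ge0//; last by rewrite ltW// pw//; case: (i : nat) iodd i1 => [|[]].
  apply/ltW/coef_Qpoly_sign => //; first by rewrite -ltnS.
  by move: (i : nat) iodd => k; lia.
(* There are [d - 4 >= 2] negative roots, so one differs from [- x]. *)
have [z [z0 zx Qz]] : exists z, [/\ 0 < z, z != x & p.[- z] = 0].
  have neg y : y \in s -> 0 < - y /\ p.[- - y] = 0.
    by rewrite opprK oppr_gt0 => /rs[? /eqP].
  case: s us ss neg {rs} => [|u [|v s]]/=; [by lia|by lia|].
  rewrite inE negb_or => /andP[/andP[uv _] _] _ neg.
  have [ux|] := eqVneq (- u) x; last first.
    by exists (- u); have [] := neg u _; rewrite ?mem_head.
  exists (- v); have [|? ?] := neg v; first by rewrite !inE eqxx orbT.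
  by split=> //; rewrite -ux eqr_opp eq_sym.
have Ex : p.[x] + p.[- x] = 0 by rewrite Qx QNx addr0.
have Ox : p.[x] - p.[- x] = 0 by rewrite Qx QNx subr0.
(* Since [p(-z) = 0], both combinations at [z] equal [p(z)]; comparison with [x], where both vanish,
   gives [p(z)] two opposite signs. *)
move: zx; rewrite neq_lt => /orP[zx|xz].
  have := evenlt _ _ z0 zx; have := oddlt _ _ z0 zx.
  rewrite Ex Ox Qz !mul0r subr0 addr0 pmulr_llt0// pmulr_lgt0 ?exprn_gt0// => /lt_trans/[apply].
  by rewrite ltxx.
have := evenlt _ _ x0 xz; have := oddlt _ _ x0 xz.
rewrite Ex Ox Qz !mul0r subr0 addr0 pmulr_llt0 ?exprn_gt0// pmulr_lgt0// => Q1 Q2.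
by have := lt_trans Q1 Q2; rewrite ltxx.
Qed.

(** * The property separating two components *)

(** For [y < 0 < x], the condition [x + y < 0] means [|x| < |y|]. *)
Definition far_negative_root (R : realType) (d : nat) (a : 'rV[R]_d) : Prop :=
  exists x y, [/\ 0 < x, root (Qpoly a) x, y < 0, root (Qpoly a) y & x + y < 0].

Lemma near_far_negative_root (R : realType) (d : nat) (b : 'rV[R]_d) :
  no_multiple_real_root (Qpoly b) -> far_negative_root b ->
  \forall a \near b, far_negative_root a.
Proof.
(* [m] is the midpoint of [x] and [- y], a threshold between the two moduli that survives
   perturbation. *)
move=> simple_b [x [y [x0 rx y0 ry xy]]]; pose m := (x - y) / 2.
have xm : x < m by rewrite /m; lra.
have ym : y < - m by rewrite /m; lra.
have near_x : nbhs x [set t | 0 < t < m].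
  by near=> t; apply/andP; split; near: t; [exact: lt_nbhsr|exact: lt_nbhsl].
have near_y : nbhs y [set t | t < - m] by exact: lt_nbhsl.
apply: (filterS2 _ _ (near_simple_root near_x rx (simple_b _ rx))
                    (near_simple_root near_y ry (simple_b _ ry))) => a.
move=> [x' /= /andP[x'0 x'm] rx'] [y' /= y'm ry'].
by exists x', y'; split=> //; lra.
Unshelve. all: by end_near. Qed.

(** The negation only gives the closed condition [x + y >= 0]. [Aset_no_opposite_roots] makes it
    strict, hence open, and [near_root_tuples] makes it uniform over all pairs of roots. *)
Lemma near_no_far_negative_root (R : realType) (d : nat) (b : 'rV[R]_d) :
  (6 <= d)%N -> Aset R d b -> ~ far_negative_root b ->
  \forall a \near b, ~ far_negative_root a.
Proof.
move=> d6 bA nfar; have [b0 _ _ _ _] := bA.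
have Q0 : (Qpoly b).[0] != 0 by apply: horner_Qpoly0 => //; lia.
pose i0 : 'I_2 := ord0; pose i1 : 'I_2 := ord_max.
pose P (a : 'rV[R]_d) (r : 'rV[R]_2) := (forall i, root (Qpoly a) (r ord0 i)) ->
  0 < r ord0 i0 -> r ord0 i1 < 0 -> 0 < r ord0 i0 + r ord0 i1.
have Ploc (r : 'rV[R]_2) : \forall r' \near r & a \near b, P a r'.
  have cvr i : (fun z : 'rV[R]_2 * 'rV[R]_d => z.1 ord0 i) @ nbhs (r, b)
      --> r ord0 i by apply: cvg_coord; exact: cvg_fst.
  have cva : (fun z : 'rV[R]_2 * 'rV[R]_d => z.2) @ nbhs (r, b) --> b.
    exact: cvg_snd.
  have [rr|] := pselect (forall i, root (Qpoly b) (r ord0 i)); last first.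
    move=> /existsNP[i /negP ri].
    have near_i : nbhs (r, b) (fun z : 'rV[R]_2 * 'rV[R]_d =>
        (Qpoly z.2).[z.1 ord0 i] != 0).
      exact: (cvgr_neq0 _ (cvg_Qpoly _ cva (cvr i)) ri).
    by apply: (filterS _ near_i) => -[r' a]/= ra; move=> /(_ i); rewrite rootE (negPf ra).
  have r0 i : r ord0 i != 0.
    by apply: contraTneq (rr i) => ->; rewrite rootE.
  have := r0 i0; rewrite neq_lt => /orP[x0|x0].
    have near_x : nbhs (r, b) (fun z : 'rV[R]_2 * 'rV[R]_d => z.1 ord0 i0 < 0).
      exact: (cvgr_lt _ (cvr i0)).
    by apply: (filterS _ near_x) => -[r' a]/= x0' _ /(lt_trans x0'); rewrite ltxx.
  have := r0 i1; rewrite neq_lt => /orP[y0|y0]; last first.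
    have near_y : nbhs (r, b) (fun z : 'rV[R]_2 * 'rV[R]_d => 0 < z.1 ord0 i1).
      exact: (cvgr_gt _ (cvr i1)).
    by apply: (filterS _ near_y) => -[r' a]/= y0' _ _ /(lt_trans y0'); rewrite ltxx.
  have xy : 0 < r ord0 i0 + r ord0 i1.
    rewrite lt_neqAle eq_sym addr_eq0; apply/andP; split.
      apply/eqP => xyE; have := Aset_no_opposite_roots d6 bA x0 (rr i0).
      by rewrite xyE opprK; apply; exact: rr.
    rewrite leNgt; apply/negP => xy; apply: nfar.
    by exists (r ord0 i0), (r ord0 i1); split=> //; exact: rr.
  have cxy : (fun z : 'rV[R]_2 * 'rV[R]_d => z.1 ord0 i0 + z.1 ord0 i1)
      @ nbhs (r, b) --> r ord0 i0 + r ord0 i1 by exact: cvgD.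
  have near_xy : nbhs (r, b) (fun z : 'rV[R]_2 * 'rV[R]_d =>
      0 < z.1 ord0 i0 + z.1 ord0 i1) by exact: (cvgr_gt _ cxy).
  by apply: (filterS _ near_xy) => -[r' a]/= xy' _ _ _.
apply: (filterS _ (near_root_tuples Ploc)) => a Pa [x [y [x0 rx y0 ry xy]]].
have rr i : root (Qpoly a) ((\row_(i < 2) if i == i0 then x else y) ord0 i).
  by rewrite mxE; case: ifP.
have := Pa _ rr rr; rewrite !mxE/= => /(_ x0 y0)/(lt_trans xy).
by rewrite ltxx.
Qed.

Lemma near_Aset_far (R : realType) (d : nat) (b : 'rV[R]_d) :
  (6 <= d)%N -> R3 R d b -> \forall a \near b, R3 R d a ->
    (Aset R d a /\ far_negative_root a <-> Aset R d b /\ far_negative_root b).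
Proof.
move=> d6 b3; have near_A := near_Aset (leq_trans (isT : 0 < 6)%N d6) b3.
have [bA|nbA] := pselect (Aset R d b); last first.
  by apply: (filterS _ near_A) => a aA /aA E; split=> [[/E]|[]] /nbA.
have [bfar|bfar] := pselect (far_negative_root b).
  apply: (filterS2 _ _ near_A (near_far_negative_root (proj2 b3) bfar)) => a E afar /E aA.
  by split=> _; split=> //; exact/aA.
apply: (filterS2 _ _ near_A (near_no_far_negative_root d6 bA bfar)) => a E afar /E aA.
by split=> -[].
Qed.

(** * Polynomials with well separated roots *)

Lemma Qpoly_row (R : realType) (d : nat) (p : {poly R}) :
  p \is monic -> size p = d.+1 -> Qpoly (\row_(j < d) p`_j) = p.
Proof.
move=> /monicP p1 sp; rewrite -[RHS]coefK poly_def sp big_ord_recr/= addrC.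
have -> : p`_d = 1 by rewrite -p1 lead_coefE sp.
rewrite scale1r; congr (_ + _); apply: eq_bigr => j _.
by rewrite mxE mul_polyC.
Qed.

(** Each expression tends to [c0 j] as [e] tends to [0] from the right. The quadratic term is for
    products with [quad]; linear factors take [c2 = 0]. *)
Lemma small_perturbation (R : realType) (M : R) (n : nat) (c0 c1 c2 : nat -> R) :
  0 < M -> (forall j, (j < n)%N -> c0 j != 0) ->
  exists e, [/\ 0 < e, e < M & forall j, (j < n)%N ->
    Num.sg (c0 j + e * c1 j + e ^+ 2 * c2 j) = Num.sg (c0 j)].
Proof.
move=> M0 c0n.
have near_j (j : 'I_n) : \forall e \near (0 : R)^'+,
    Num.sg (c0 j + e * c1 j + e ^+ 2 * c2 j) = Num.sg (c0 j).
  have cj : (fun e : R => c0 j + e * c1 j + e ^+ 2 * c2 j) @ (0 : R)^'+ --> c0 j.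
    have id0 : (fun e : R => e) @ (0 : R)^'+ --> (0 : R).
      by apply: cvg_at_right_filter; exact: cvg_id.
    have lim0 : c0 j + 0 * c1 j + 0 ^+ 2 * c2 j = c0 j.
      by rewrite expr0n !mul0r !addr0.
    rewrite -[X in _ --> X]lim0; apply: cvgD; first apply: cvgD.
    - exact: cvg_cst.
    - by apply: cvgM => //; exact: cvg_cst.
    - by apply: cvgM; [exact: cvg_exprn|exact: cvg_cst].
  exact: (near_sgr _ cj (c0n _ (ltn_ord j))).
have near_all := filter_forall _ near_j.
near (0 : R)^'+ => e; exists e; split=> [||j jn].
- by near: e; exact: nbhs_right_gt.
- by near: e; exact: nbhs_right_lt.
- have eP : forall j : 'I_n,
      Num.sg (c0 j + e * c1 j + e ^+ 2 * c2 j) = Num.sg (c0 j).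
    by near: e; exact: near_all.
  exact: (eP (Ordinal jn)).
Unshelve. all: by end_near. Qed.

(** The positive roots are fixed at [1] and [2]; [s] is to list the negative ones. *)
Definition roots_poly (R : realType) (s : seq R) : {poly R} :=
  \prod_(r <- [:: 1, 2 & s]) ('X - r%:P).

Lemma roots_poly_cons (R : realType) (y : R) (s : seq R) :
  roots_poly (y :: s) = ('X - y%:P) * roots_poly s.
Proof. by rewrite /roots_poly !big_cons; ring. Qed.

Lemma coef_mul_XsubC (R : realType) (y : R) (p : {poly R}) (j : nat) :
  (('X - y%:P) * p)`_j = (if j is i.+1 then p`_i else 0) - y * p`_j.
Proof. by rewrite mulrBl coefB coefXM coefCM; case: j. Qed.

Lemma coef_roots_poly_nil (R : realType) :
  [/\ (roots_poly [::])`_0 = 2 :> R, (roots_poly [::])`_1 = - 3 :> R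
    & (roots_poly [::])`_2 = 1 :> R].
Proof.
rewrite /roots_poly !big_cons big_nil.
by split; rewrite !coef_mul_XsubC !coef1/=; ring.
Qed.

(** The discriminant is [-3 c^2], so this factor carries the complex conjugate pair, of modulus
    [|c|]. *)
Definition quad (R : realType) (c : R) : {poly R} := 'X^2 - c%:P * 'X + (c ^+ 2)%:P.

Lemma coef_mul_quad (R : realType) (c : R) (p : {poly R}) (j : nat) :
  (quad c * p)`_j = (if j is i.+2 then p`_i else 0)
    - c * (if j is i.+1 then p`_i else 0) + c ^+ 2 * p`_j.
Proof.
rewrite /quad mulrDl mulrBl coefD coefB coefXnM -mulrA !coefCM coefXM.
by case: j => [|[|j]] //=; rewrite subn2.
Qed.

Lemma horner_quad_gt0 (R : realType) (c x : R) : c != 0 -> 0 < (quad c).[x].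
Proof.
move=> c0; rewrite /quad !hornerE.
have c2 : 0 < c ^+ 2 by rewrite exprn_even_gt0.
have -> : x ^+ 2 - c * x + c ^+ 2 = (x - c / 2) ^+ 2 + c ^+ 2 * (3 / 4) by field.
by rewrite ltr_wpDl ?sqr_ge0// mulr_gt0// divr_gt0.
Qed.

Lemma size_quad (R : realType) (c : R) : size (quad c) = 3%N.
Proof.
have -> : quad c = ('X - c%:P) * 'X + (c ^+ 2)%:P by rewrite /quad; ring.
by rewrite size_MXaddC polyXsubC_eq0 size_XsubC.
Qed.

Lemma monic_quad (R : realType) (c : R) : quad c \is monic.
Proof.
by rewrite monicE lead_coefE size_quad /quad !coefE/=; apply/eqP; ring.
Qed.

Lemma size_roots_poly (R : realType) (s : seq R) :
  size (roots_poly s) = (size s).+3.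
Proof. by rewrite /roots_poly size_prod_XsubC. Qed.

(** The quadratic factor has no real root and the linear factors are distinct, so membership in
    [Aset] reduces to the signs of the coefficients. *)
Lemma Aset_roots_poly (R : realType) (d : nat) (s : seq R) (c : R) :
  let p := quad c * roots_poly s in let a := \row_(j < d) p`_j in
  d = (size s + 4)%N -> uniq s -> (forall y, y \in s -> y < 0) -> c != 0 ->
  (forall j, (j < d)%N -> if (j == d.-1) || (j == 1%N) then p`_j < 0 else 0 < p`_j) ->
  Aset R d a /\ (forall x, root (Qpoly a) x = (x \in [:: 1, 2 & s])).
Proof.
move=> p a dE us sneg c0 sp.
have us12 : uniq [:: 1, 2 & s].
  have nots (x : R) : 0 < x -> x \notin s.
    by move=> x0; apply/negP => /sneg /(lt_trans x0); rewrite ltxx.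
  by rewrite /= us inE negb_or !nots// eq_sym gt_eqF// ltr1n.
have prE x : root p x = (x \in [:: 1, 2 & s]).
  by rewrite /p rootM root_prod_XsubC rootE gt_eqF// horner_quad_gt0.
have Qa : Qpoly a = p.
  apply: Qpoly_row; first by rewrite rpredM// ?monic_quad// monic_prod_XsubC.
  rewrite size_monicM ?monic_quad ?monic_neq0 ?monic_prod_XsubC//.
  by rewrite size_quad size_roots_poly dE; lia.
have simple_p : no_multiple_real_root p.
  move=> x; rewrite /p rootM => /orP[|rx].
    by rewrite rootE gt_eqF// horner_quad_gt0.
  (* At a root of [roots_poly s] the derivative of [p] reduces to [quad c] times that of
     [roots_poly s], non-zero by separability. *)
  rewrite derivM rootE hornerD !hornerM (eqP rx) mulr0 add0r mulf_neq0//.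
    by rewrite gt_eqF// horner_quad_gt0.
  have : separable_poly (roots_poly s) by rewrite separable_prod_XsubC.
  by rewrite unlock => sep; exact: (coprimep_root sep rx).
have sa : sigma_bullet a by move=> j; have := sp j (ltn_ord j); rewrite mxE.
split=> [|x]; last by rewrite Qa prE.
split=> //.
- by move=> j; have := sa j; case: ifP => _; [exact: ltr0_neq0|exact: lt0r_neq0].
- by rewrite Qa.
- exists [:: 1; 2]; split=> // [|x]; first by rewrite /= inE eq_sym gt_eqF// ltr1n.
  rewrite Qa prE !inE; split=> [/orP[/eqP->|/eqP->]|[/= x0]].
  + by split=> //=; rewrite eqxx.
  + by split=> //=; rewrite eqxx orbT.
  + by case/or3P => [->|->|/sneg /(lt_trans x0)]; rewrite ?orbT// ltxx.
- exists s; split=> // [|x]; first by rewrite dE addnK.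
  rewrite Qa prE !inE; split=> [xs|[/= x0]].
    by split; [exact: sneg|rewrite xs !orbT].
  by case/or3P => // /eqP xE; move: x0; rewrite xE ltNge ?ler01 ?ler0n.
Qed.

(* The negative roots are introduced one by one, each much smaller than all
   previous ones, so that the signs of the old coefficients are just shifted. *)
Lemma small_negative_roots (R : realType) (k : nat) :
  exists (s : seq R) (M : R), [/\ uniq s, size s = k, 0 < M,
    forall y, y \in s -> -1 < y < - M &
    forall j, (j <= k.+2)%N ->
      if j == k.+1 then (roots_poly s)`_j < 0 else 0 < (roots_poly s)`_j].
Proof.
elim: k => [|k [s [M [us ss M0 sM sg]]]].
  have [c0 c1 c2] := coef_roots_poly_nil R.
  by exists [::], 1; split=> // -[|[|[|j]]]//= _; rewrite ?c0 ?c1 ?c2 ?ltrN10 ?oppr_lt0.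
have sg0 j : (j < k.+3)%N -> (roots_poly s)`_j != 0.
  by rewrite ltnS => /sg; case: ifP => _; [exact: ltr0_neq0|exact: lt0r_neq0].
(* [e < M] separates [- e] from the old roots, and [e < 1] keeps it above [-1]. *)
have M1 : 0 < Num.min M 1 by rewrite lt_min M0 ltr01.
(* With [P = roots_poly s], degree [j+1] of [(X + e) P] has coefficient [P_j + e P_(j+1)]. *)
have [e [e0 eM eP]] := small_perturbation (fun j => (roots_poly s)`_j.+1) (fun=> 0) M1 sg0.
move: eM; rewrite lt_min => /andP[eM e1].
exists (- e :: s), (e / 2); split => /=.
- by rewrite us andbT; apply/negP => /sM; lra.
- by rewrite ss.
- by rewrite divr_gt0.
- by move=> y; rewrite inE => /predU1P[->|/sM]; lra.
- move=> [|j] jk; rewrite roots_poly_cons coef_mul_XsubC mulNr opprK.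
    by have := sg 0%N isT; rewrite /= add0r => ?; exact: mulr_gt0.
  have := eP j jk; have := sg j jk; rewrite mulr0 addr0 eqSS.
  by move=> sj E; rewrite (eq_sgr_lt0 E) (eq_sgr_gt0 E).
Qed.

(* Same as above with each new root much larger in modulus than all previous
   ones, so that the signs of the old coefficients stay in place. *)
Lemma large_negative_roots (R : realType) (k : nat) :
  exists (s : seq R) (M : R), [/\ uniq s, size s = k, 0 < M,
    forall y, y \in s -> - M < y < - 2 &
    forall j, (j <= k.+2)%N ->
      if j == 1%N then (roots_poly s)`_j < 0 else 0 < (roots_poly s)`_j].
Proof.
elim: k => [|k [s [M [us ss M0 sM sg]]]].
  have [c0 c1 c2] := coef_roots_poly_nil R.
  by exists [::], 1; split=> // -[|[|[|j]]]//= _; rewrite ?c0 ?c1 ?c2 ?ltrN10 ?oppr_lt0.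
have sg0 j : (j < k.+3)%N -> (roots_poly s)`_j != 0.
  by rewrite ltnS => /sg; case: ifP => _; [exact: ltr0_neq0|exact: lt0r_neq0].
(* [e < 1/(M+2)] puts the new root [- 1/e] below [- 2] and below all old roots. *)
have M1 : 0 < (M + 2)^-1 by rewrite invr_gt0; lra.
have [e [e0 eM eP]] := small_perturbation
  (fun j => if j is i.+1 then (roots_poly s)`_i else 0) (fun=> 0) M1 sg0.
have Me : M + 2 < e^-1 by rewrite -[M + 2]invrK ltf_pV2 ?posrE.
exists (- e^-1 :: s), (e^-1 + 1); split => /=.
- by rewrite us andbT; apply/negP => /sM; lra.
- by rewrite ss.
- lra.
- by move=> y; rewrite inE => /predU1P[->|/sM]; lra.
- move=> j jk; rewrite roots_poly_cons coef_mul_XsubC mulNr opprK.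
  set q := (X in X + _ < 0).
  have qE : q + e^-1 * (roots_poly s)`_j = e^-1 * ((roots_poly s)`_j + e * q).
    by field; rewrite gt_eqF.
  rewrite qE pmulr_rlt0 ?pmulr_rgt0 ?invr_gt0//.
  move: jk; rewrite leq_eqVlt => /predU1P[jE|jk].
    (* In the new top degree the old coefficient vanishes, and the shifted leading coefficient
       decides the sign. *)
    rewrite /q {q qE} jE /=; have /= := sg k.+2 (leqnn _) => ?.
    rewrite [(roots_poly s)`_k.+3]nth_default ?add0r ?mulr_gt0//.
    by rewrite size_roots_poly ss.
  have := eP j jk; have := sg j jk; rewrite mulr0 addr0 -/q.
  by move=> sj E; rewrite (eq_sgr_lt0 E) (eq_sgr_gt0 E).
Qed.

Lemma roots_poly_lead (R : realType) (s : seq R) : (roots_poly s)`_(size s).+2 = 1.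
Proof.
have /monicP := monic_prod_XsubC [:: 1, 2 & s] predT id.
by rewrite lead_coefE size_prod_XsubC.
Qed.

(** * The two witnesses *)

(** Multiplying by [quad e] with small [e] shifts the signs of [P] up by two degrees, taking the
    minus sign to [d-1]; the new minus sign in degree [1] comes from [- e P_0]. *)
Lemma exists_Aset_not_far (R : realType) (d : nat) : (6 <= d)%N ->
  exists a : 'rV[R]_d, Aset R d a /\ ~ far_negative_root a.
Proof.
move=> d6; pose k := (d - 4)%N; have dk : d = k.+4 by rewrite /k; lia.
have [s [M [us ss M0 sM sg]]] := small_negative_roots R k.
set P := roots_poly s in sg.
(* Index [j] stands for degree [j+1] of the product; the entry for degree [1] is divided by [e]. *)
pose c0 j := if j is i.+1 then P`_i else - P`_0.
have c0n j : (j < k.+3.+1)%N -> c0 j != 0.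
  have P0 i : (i <= k.+2)%N -> P`_i != 0.
    by move=> /sg; case: ifP => _; [exact: ltr0_neq0|exact: lt0r_neq0].
  by case: j => [|j] jk; rewrite /= ?oppr_eq0 P0.
have [e [e0 _ eP]] := small_perturbation
  (fun j => if j is i.+1 then - P`_i.+1 else P`_1)
  (fun j => if j is i.+1 then P`_i.+2 else 0) (ltr01 : 0 < 1 :> R) c0n.
have [||||j jd|aA ra] := @Aset_roots_poly R d s e.
- by rewrite ss dk; lia.
- exact: us.
- by move=> y /sM /andP[_ /lt_trans]; apply; rewrite oppr_lt0.
- exact: lt0r_neq0.
- rewrite coef_mul_quad -/P; case: j jd => [|[|j]] jd.
  + rewrite dk/= mulr0 subr0 add0r mulr_gt0 ?exprn_gt0//.
    exact: (sg 0%N isT).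
  + rewrite orbT; have := eP 0%N isT; rewrite /= mulr0 addr0 => E.
    have -> : 0 - e * P`_0 + e ^+ 2 * P`_1 = e * (- P`_0 + e * P`_1) by ring.
    rewrite pmulr_rlt0// (eq_sgr_lt0 E) oppr_lt0.
    exact: (sg 0%N isT).
  + have jk : (j <= k.+2)%N by rewrite dk in jd; lia.
    have := eP j.+1 jk; have := sg j jk; rewrite /= dk/= !eqSS orbF.
    by rewrite mulrN => sj E; rewrite (eq_sgr_lt0 E) (eq_sgr_gt0 E).
eexists; split; first exact: aA.
move=> [x [y []]]; rewrite !ra !inE => x0 xs y0 ys.
(* Positive roots are at least [1] and negative ones exceed [-1], so no such sum is negative. *)
have : 1 <= x.
  case/or3P: xs => [/eqP->//|/eqP->|/sM]; first by rewrite ler1n.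
  by move=> /andP[_ xM]; lra.
have : -1 < y.
  by case/or3P: ys => [/eqP->|/eqP->|/sM /andP[]//]; lra.
lra.
Qed.

(** Multiplying by [quad (1/e)] with small [e] keeps the signs of [P] in place up to degree [d-2];
    in degree [d-1] the term [- 1/e] from the leading coefficient of [P] dominates. *)
Lemma exists_Aset_far (R : realType) (d : nat) : (6 <= d)%N ->
  exists a : 'rV[R]_d, Aset R d a /\ far_negative_root a.
Proof.
move=> d6; pose k := (d - 4)%N; have dk : d = k.+4 by rewrite /k; lia.
have [s [M [us ss M0 sM sg]]] := large_negative_roots R k.
have P1 := roots_poly_lead s; rewrite ss in P1.
set P := roots_poly s in sg P1.
(* [k+3] is [d-1]. The coefficient there is rescaled by [e], all others by [e^2]. *)
pose c0 j := if j == k.+3 then - 1 else P`_j.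
have c0n j : (j < k.+3.+1)%N -> c0 j != 0.
  rewrite /c0; case: (eqVneq j k.+3) => [_ _|jk]; first by rewrite ltr0_neq0 ?ltrN10.
  rewrite ltnS leq_eqVlt (negPf jk) => /sg.
  by case: ifP => _; [exact: ltr0_neq0|exact: lt0r_neq0].
have [e [e0 _ eP]] := small_perturbation
  (fun j => if j == k.+3 then P`_k.+1 else if j is i.+1 then - P`_i else 0)
  (fun j => if j == k.+3 then 0 else if j is i.+2 then P`_i else 0)
  (ltr01 : 0 < 1 :> R) c0n.
have e_neq0 := lt0r_neq0 e0.
have [||||j jd|aA ra] := @Aset_roots_poly R d s e^-1.
- by rewrite ss dk; lia.
- exact: us.
- by move=> y /sM /andP[_ /lt_trans]; apply; rewrite oppr_lt0.
- by rewrite invr_eq0.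
- rewrite -/P dk/=; have := eP j; rewrite -dk => /(_ jd).
  rewrite /c0; have [->|jk] := eqVneq j k.+3.
    have P0 : P`_k.+3 = 0 by rewrite nth_default// size_roots_poly ss.
    rewrite coef_mul_quad /= P0 !mulr0 !addr0 P1 => E.
    have -> : P`_k.+1 - e^-1 * 1 = e^-1 * (-1 + e * P`_k.+1) by field.
    by rewrite pmulr_rlt0 ?invr_gt0// (eq_sgr_lt0 E) ltrN10.
  have jk' : (j <= k.+2)%N by rewrite dk in jd; lia.
  set t := (X in Num.sg X = _) => E; have := sg j jk'.
  have -> : (quad e^-1 * P)`_j = e^-1 ^+ 2 * t.
    by rewrite coef_mul_quad /t; case: (j) => [|[|i]]; field.
  rewrite pmulr_rlt0 ?pmulr_rgt0 ?exprn_gt0 ?invr_gt0//=.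
  by rewrite (eq_sgr_lt0 E) (eq_sgr_gt0 E).
eexists; split; first exact: aA.
have [y ys] : exists y, y \in s.
  by case: (s) ss => [|y s' _]; [rewrite /k/=; lia|exists y; rewrite mem_head].
exists 1, y; rewrite !ra !inE eqxx ys !orbT; have /andP[_ y2] := sM y ys.
by split=> //; lra.
Qed.

Theorem theorem1 (R : realType) (d : nat) (hd : (6 <= d)%N) :
  Aset R d !=set0 /\
  ~ connected (Aset R d) /\
  (forall a, Aset R d a -> connected_component (R3 R d) a `<=` Aset R d) /\
  (exists a b, [/\ Aset R d a, Aset R d b &
     connected_component (R3 R d) a <> connected_component (R3 R d) b]).
Proof.
have AR3 : Aset R d `<=` R3 R d by move=> a [].
have [a [aA afar]] := exists_Aset_far R hd.
have [b [bA bnear]] := exists_Aset_not_far R hd.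
(* The component of [a] retains the far negative root that [b] lacks. *)
have sep : connected_component (R3 R d) a `<=`
    [set c | Aset R d c /\ far_negative_root c].
  apply: connected_component_locally_const => //; last exact: AR3.
  by move=> c; exact: near_Aset_far.
have nab : ~ connected_component (R3 R d) a b by move=> /sep[].
split; first by exists a.
split.
  (* A connected [Aset] would lie in the component of [a], and so would [b]. *)
  by move=> cA; apply: nab; exact: (connected_component_max aA AR3 cA).
split.
  move=> c cA; apply: connected_component_locally_const => //; last exact: AR3.
  by move=> c'; apply: near_Aset; lia.
exists a, b; split=> // ab; apply: nab; rewrite ab.
by apply: connected_component_refl; exact: AR3.
Qed.
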